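(* Let $\mathfrak{p}$ be a nonzero divided prime ideal of a subtractive semidomain $S$. Then $\mathfrak{p}^2$ is a 2-absorbing ideal of $S$.
   Context: A semiring is a set $S$ with operations $+,\cdot$ and elements $0\neq 1$ such that $(S,+,0)$ is a commutative monoid, $(S,\cdot,1)$ is a monoid, multiplication distributes over addition on both sides, and $a\cdot 0=0\cdot a=0$ for all $a\in S$. All semirings are assumed commutative (multiplication is commutative). A semidomain is a semiring in which $xy=xz$ and $x\neq 0$ imply $y=z$. An ideal of $S$ is a nonempty subset $\mathfrak{a}$ closed under addition with $sx\in\mathfrak{a}$ for all $s\in S$, $x\in\mathfrak{a}$; it is proper if $\mathfrak{a}\neq S$; $(x)$ is the principal ideal generated by $x$. The product of ideals is $IJ=\{\sum_{i=1}^n a_ib_i : a_i\in I,\ b_i\in J,\ n\in\mathbb{N}\}$, and $\mathfrak{p}^2=\mathfrak{p}\mathfrak{p}$. An ideal $\mathfrak{a}$ is subtractive if $x+y\in\mathfrak{a}$ and $x\in\mathfrak{a}$ imply $y\in\mathfrak{a}$ for all $x,y\in S$; $S$ is subtractive if every ideal of $S$ is subtractive. A proper ideal $\mathfrak{p}$ is prime if $ab\in\mathfrak{p}$ implies $a\in\mathfrak{p}$ or $b\in\mathfrak{p}$. A prime ideal $\mathfrak{p}$ is divided if $\mathfrak{p}\subsetneq(x)$ for every $x\in S\setminus\mathfrak{p}$. A proper ideal $\mathfrak{a}$ is 2-absorbing if, for $x,y,z\in S$, $xyz\in\mathfrak{a}$ implies $xy\in\mathfrak{a}$ or $yz\in\mathfrak{a}$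 or $xz\in\mathfrak{a}$. *)

(* Defs.v *)
From mathcomp Require Import all_boot all_algebra.
From mathcomp Require Import boolp classical_sets.

Set Implicit Arguments.
Unset Strict Implicit.
Unset Printing Implicit Defensive.

Import GRing.Theory.

Local Open Scope classical_set_scope.
Local Open Scope ring_scope.

Section SemiringIdeals.
Variable S : comNzSemiRingType.
Implicit Types I J a p : set S.

Definition semidomain := forall x y z : S, x * y = x * z -> x <> 0 -> y = z.

Definition is_ideal I :=
  [/\ I !=set0,
      forall x y, I x -> I y -> I (x + y)
    & forall s x, I x -> I (s * x)].

Definition proper_ideal I := is_ideal I /\ I <> [set: S].

(* Already an ideal, since S is commutative and has a multiplicative identity. *)
Definition principal (x : S) : set S := [set s * x | s in [set: S]].

Definition ideal_mul I J : set S :=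
  [set u | exists (n : nat) (f g : 'I_n -> S),
     [/\ forall i, I (f i), forall i, J (g i) & u = \sum_(i < n) f i * g i]].

Definition subtractive_ideal a :=
  is_ideal a /\ forall x y, a (x + y) -> a x -> a y.

Definition subtractive_semiring := forall a, is_ideal a -> subtractive_ideal a.

Definition prime_ideal p :=
  proper_ideal p /\ forall x y, p (x * y) -> p x \/ p y.

Definition divided_prime_ideal p :=
  prime_ideal p /\ forall x, ~ p x -> p `<` principal x.

Definition two_absorbing_ideal a :=
  proper_ideal a /\
  forall x y z, a (x * y * z) -> [\/ a (x * y), a (y * z) | a (x * z)].

End SemiringIdeals.

Arguments semidomain S : clear implicits.
Arguments subtractive_semiring S : clear implicits.

(* Main.v *)
Require Import Defs.
From mathcomp Require Import all_boot all_algebra.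
From mathcomp Require Import boolp classical_sets.

(** If [w] lies outside the divided prime [p], then [p] is contained in [(w)], and
primality gives [p = w p], hence [p^2 = w p^2].  By cancellation,
[x w \in p^2] forces [x \in p^2].  Now let [x y z \in p^2].  As [p^2] is
contained in [p], some factor lies in [p]; if two do, their product is in [p^2];
if only one does, cancelling the product of the other two puts it in [p^2]. *)

Import GRing.Theory.

Local Open Scope classical_set_scope.
Local Open Scope ring_scope.

Lemma ideal0 (S : comNzSemiRingType) (I : set S) : is_ideal I -> I 0.
Proof. by case=> -[x Ix] _ IM; rewrite -(mul0r x); apply: IM. Qed.

Lemma ideal_sum (S : comNzSemiRingType) (I : set S) (n : nat) (F : 'I_n -> S) :
  is_ideal I -> (forall i, I (F i)) -> I (\sum_(i < n) F i).
Proof.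
move=> idI IF; have [_ ID _] := idI.
by elim/big_ind: _ => [|x y|i _]; [exact: ideal0 | exact: ID | exact: IF].
Qed.

Lemma proper_ideal1 {S : comNzSemiRingType} {I : set S} :
  is_ideal I -> (I <> [set: S]) <-> ~ I 1.
Proof.
move=> [_ _ IM]; split=> [IT I1|I1 IT]; last by apply: I1; rewrite IT.
by apply: IT; apply/seteqP; split=> // s _; rewrite -(mulr1 s); apply: IM.
Qed.

Lemma mem_ideal_mul (S : comNzSemiRingType) (I J : set S) (x y : S) :
  I x -> J y -> ideal_mul I J (x * y).
Proof.
by move=> Ix Jy; exists 1%N, (fun=> x), (fun=> y); split; rewrite ?big_ord1.
Qed.

Lemma ideal_mul_subr {S : comNzSemiRingType} {I J : set S} :
  is_ideal J -> ideal_mul I J `<=` J.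
Proof.
move=> idJ _ [n [f [g [_ Jg ->]]]]; apply: ideal_sum => // i.
by have [_ _ JM] := idJ; apply: JM.
Qed.

Lemma ideal_mul_ideal {S : comNzSemiRingType} {I : set S} (J : set S) :
  is_ideal I -> is_ideal (ideal_mul I J).
Proof.
move=> idI; have [_ _ IM] := idI; split.
(* The empty sum shows nonemptiness; its families, indexed by ['I_0], meet every membership
   condition vacuously. *)
- exists 0, 0%N, (fun=> 0), (fun=> 0).
  by split=> [[]|[]|] //; rewrite big_ord0.
- move=> _ _ [n [f [g [If Jg ->]]]] [m [f' [g' [If' Jg' ->]]]].
  (* Adding two sums of products amounts to concatenating their families of factors. *)
  pose glue (h : 'I_n -> S) (h' : 'I_m -> S) (i : 'I_(n + m)) :=
    match split i with inl j => h j | inr k => h' k end.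
  exists (n + m)%N, (glue f f'), (glue g g'); split.
  + by move=> i; rewrite /glue; case: (split i).
  + by move=> i; rewrite /glue; case: (split i).
  rewrite big_split_ord /=; congr (_ + _); apply: eq_bigr => i _; rewrite /glue.
    by rewrite (unsplitK (inl i)).
  by rewrite (unsplitK (inr i)).
- move=> s _ [n [f [g [If Jg ->]]]].
  exists n, (fun i => s * f i), g; split=> // [i|]; first exact: IM.
  by rewrite big_distrr /=; apply: eq_bigr => i _; rewrite mulrA.
Qed.

(** Dividedness writes [a] as a multiple [s * w]; since [w] is outside [p], primality forces the
    cofactor [s] into [p]. *)
Lemma divided_prime_factor {S : comNzSemiRingType} {p : set S} {w a : S} :
  divided_prime_ideal p -> ~ p w -> p a -> exists2 b, p b & a = w * b.
Proof.
move=> [[_ p_prime] p_div] pNw pa.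
have [s _ saw] := (p_div w pNw).1 a pa.
exists s; last by rewrite mulrC.
by have [//|/pNw] : p s \/ p w by apply: p_prime; rewrite saw.
Qed.

Lemma divided_prime_mul_cancel (S : comNzSemiRingType) (p J : set S) (w x : S) :
  semidomain S -> divided_prime_ideal p -> ~ p w ->
  ideal_mul p J (w * x) -> ideal_mul p J x.
Proof.
move=> cancelS p_div pNw [n [f [g [pf Jg wxE]]]].
(* Dividing every left factor [f i] by [w] turns the whole sum into [w] times an element of
   [ideal_mul p J]. *)
have /choice[h hP] i : exists b, p b /\ f i = w * b.
  by have [b pb fE] := divided_prime_factor p_div pNw (pf i); exists b.
exists n, h, g; split=> // [i|]; first by have [] := hP i.
apply: (cancelS w) => [|w0].
  by rewrite wxE big_distrr /=; apply: eq_bigr => i _; rewrite (hP i).2 mulrA.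
(* Cancellation is legitimate: [0] lies in [p] and [w] does not. *)
by apply: pNw; rewrite w0; apply: ideal0; case: p_div => -[[]].
Qed.

Theorem theorem3p11 (S : comNzSemiRingType) (p : set S)
  (S_semidomain : semidomain S)
  (S_subtractive : subtractive_semiring S)
  (p_divided : divided_prime_ideal p)
  (p_neq0 : p <> [set 0]) :
  two_absorbing_ideal (ideal_mul p p).
Proof.
have [[[p_ideal p_proper] p_prime] _] := p_divided.
have pp_ideal := ideal_mul_ideal p p_ideal.
have [_ _ ppM] := pp_ideal.
have cancel x y z : ~ p x -> ~ p y ->
    ideal_mul p p (x * y * z) -> ideal_mul p p z.
  move=> pNx pNy; apply: divided_prime_mul_cancel => //.
  by move=> /p_prime[].
split.
  (* If [1] were in the square of [p], it would be in [p]. *)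
  split=> //; apply/(proper_ideal1 pp_ideal) => /(ideal_mul_subr p_ideal).
  exact/(proper_ideal1 p_ideal).
move=> x y z xyz.
have [px|pNx] := pselect (p x); have [py|pNy] := pselect (p y);
  have [pz|pNz] := pselect (p z).
- by apply: Or31; apply: mem_ideal_mul.
- by apply: Or31; apply: mem_ideal_mul.
- by apply: Or33; apply: mem_ideal_mul.
(* Only [x] is in [p]: cancelling [y * z] puts [x], hence [x * y], in the square. *)
- apply: Or31; rewrite mulrC; apply: ppM; apply: (cancel y z) => //.
  by rewrite mulrC mulrA.
- by apply: Or32; apply: mem_ideal_mul.
- apply: Or31; apply: ppM; apply: (cancel x z) => //.
  by rewrite mulrAC.
- by apply: Or32; apply: ppM; apply: (cancel x y).
(* No factor is in [p], although primality demands one. *)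
- by have /p_prime[/p_prime[]|] := ideal_mul_subr p_ideal _ xyz.
Qed.
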